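(* Let $p=4$ or $p=6$, and let $D$ be a $p$-angulation of a polygon with $n+3$ vertices. Let $T_D^{\bullet}$ be the associated triangulation. Let $v_0,\dots,v_{n+2}$ be the vertices of the Farey path of $D$, and let $w_0,\dots,w_{n+2}$ be the vertices of the Farey path $P_T'$ of the triangulation $T_D^{\bullet}$. Then $$w_\alpha=\frac{1}{\lambda_p}v_\alpha$$ for $0\le\alpha\le n+2$.
   Context: A $p$-angulation $D$ of a convex regular polygon $P$ is a set of non-intersecting diagonals partitioning $P$ into a finite collection of $p$-gons (a triangulation is the case $p=3$). Put $\lambda_p=2\cos(\pi/p)$, so $\lambda_3=1$, $\lambda_4=\sqrt2$, $\lambda_6=\sqrt3$. Let $P$ have $n+3$ vertices, labelled $0,1,\dots,n+2$ in cyclic order (for $p\in\{4,6\}$ the existence of a $p$-angulation forces $n+3$ to be even). Every edge of the $p$-angulation $D$ then joins an even vertex to an odd vertex, so each $p$-gon of $D$ has $p/2$ odd vertices. The associated triangulation $T_D^{\bullet}$ of $P$ consists of the diagonals of $D$ together with, for every $p$-gon of $D$, all diagonals joining two odd vertices of that $p$-gon (one diagonal per $4$-gon if $p=4$, three diagonals per $6$-gon if $p=6$). For a $p'$-angulation $E$ of $P$ (any $p'\ge3$), let $q_\alpha$ be the number of $p'$-gons of $E$ incident with the vertex $\alpha$. The vertices $u_0,\dots,u_{n+2}$ of the Farey path of $E$ are the elements of $\mathbb{R}\cup\{\infty\}$ given by $u_0=\infty$ and $u_\alpha=\xi_0\xi_1\cdots\xi_{\alpha-1}(\infty)$ (composition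 of maps) for $1\le\alpha\le n+2$, where $\xi_\alpha$ is the Möbius transformation $\xi_\alpha(z)=q_\alpha\lambda_{p'}-\frac1z$. Thus the $v_\alpha$ are obtained with $E=D$, $p'=p$, and the $w_\alpha$ with $E=T_D^{\bullet}$, $p'=3$. The convention $\frac{1}{\lambda_p}\infty=\infty$ is used. *)

(* Defs.v *)
From HB Require Import structures.
From mathcomp Require Import all_boot all_order all_algebra.
From mathcomp Require Import reals trigo one_point_compactification.

Set Implicit Arguments.
Unset Strict Implicit.
Unset Printing Implicit Defensive.

Import Order.TTheory GRing.Theory Num.Theory.

Local Open Scope ring_scope.

(* Dissections of a convex polygon P with n + 3 vertices, modelled
   combinatorially: the vertices are 0, ..., n + 2 in cyclic order, and a
   segment joining two vertices is the unordered pair of its endpoints. *)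
Section Dissection.
Variable n : nat.
Implicit Types (x y z : 'I_n.+3) (D : {set {set 'I_n.+3}}).

(* For x != y: z lies strictly between x and y when P is traversed from x to y
   in increasing cyclic order. *)
Definition arc x y z : bool :=
  if (x < y)%N then (x < z < y)%N else (x < z)%N || (z < y)%N.

Definition side x y : bool := (y == ordS x) || (x == ordS y).

Definition diagonals : {set {set 'I_n.+3}} :=
  [set e : {set 'I_n.+3} |
     [exists x, exists y, [&& x != y, ~~ side x y & e == [set x; y]]]].

(* The segments [a, b] and [c, d] meet in their interiors; a common endpoint is
   not a crossing. The other orientation, with c and d exchanged, is covered
   because noncrossing quantifies over all orderings of the endpoints. *)
Definition crosses a b c d : bool := arc a b c && arc b a d.

Definition noncrossing D : Prop :=
  forall a b c d, [set a; b] \in D -> [set c; d] \in D -> ~~ crosses a b c d.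

Definition edge D x y : bool := side x y || ([set x; y] \in D).

(* For x != y in S: [x, y] is a side of the convex hull of S. *)
Definition consecutive (S : {set 'I_n.+3}) x y : bool :=
  [forall z in S, ~~ arc x y z] || [forall z in S, ~~ arc y x z].

(* Vertex sets of the polygons into which a noncrossing D cuts P. Such a
   polygon is the convex hull of at least three vertices; its sides are sides
   of P or members of D, and no member of D runs through its interior, i.e. none
   is a diagonal of it (a member of D entering the interior in any other way
   would cross one of its sides). *)
Definition cells D : {set {set 'I_n.+3}} :=
  [set S : {set 'I_n.+3} | (3 <= #|S|)%N &&
    [forall x in S, forall y in S,
       (x != y) ==> (edge D x y == consecutive S x y)]].

Definition p_angulation (p : nat) D : Prop :=
  [/\ D \subset diagonals, noncrossing D &
      forall S : {set 'I_n.+3}, S \in cells D -> #|S| = p].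

(* A diagonal of P with both ends in a cell S is a diagonal of S or belongs to
   D, so nothing but diagonals of cells is added to D. *)
Definition odd_triangulation D : {set {set 'I_n.+3}} :=
  D :|: [set e in diagonals | [exists S in cells D, e \subset S]
                              && [forall x in e, odd (x : 'I_n.+3)]].

Definition incident_cells D x : nat := #|[set S in cells D | x \in S]|.

End Dissection.

Definition lambda (R : realType) (p : nat) : R := 2 * cos (pi / p%:R).

(* R together with infinity = None. *)
Definition extended (R : realType) : Type := one_point_compactification R.

(* z |-> mu - 1 / z *)
Definition xi (R : realType) (mu : R) (z : extended R) : extended R :=
  match z with
  | None => Some mu
  | Some x => if x == 0 then None else Some (mu - x^-1)
  end.

(* z |-> a z, for a != 0 *)
Definition dilate (R : realType) (a : R) (z : extended R) : extended R :=
  omap (fun x : R => a * x) z.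

(* take alpha (enum 'I_n.+3) lists 0, ..., alpha - 1 in increasing order, so
   that foldr computes xi_0 (xi_1 (... (xi_(alpha - 1) infinity))). *)
Definition farey_path (R : realType) (n p : nat) (E : {set {set 'I_n.+3}})
    (alpha : 'I_n.+3) : extended R :=
  foldr (fun i : 'I_n.+3 => xi ((incident_cells E i)%:R * lambda R p))
        None (take alpha (enum 'I_n.+3)).

(* Main.v *)
(* At a vertex of a dissection by noncrossing diagonals, the number of cells is
   one less than the number of neighbours. Every edge of D joins vertices of
   opposite parity, so the triangulation has the neighbours of D at an even
   vertex, whereas at an odd vertex every cell contributes its p/2 - 1 other odd
   vertices as new neighbours. Hence the number q of cells at a vertex is
   unchanged at even vertices and becomes q (p/2) = q lambda_p^2 at odd ones, and
   q - 1/z and q lambda_p^2 - 1/z are the conjugates of q lambda_p - 1/z by the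
   dilations of ratio lambda_p^-1 and lambda_p, up to replacing z by a multiple
   that the next factor absorbs. *)
From mathcomp Require Import all_boot all_order all_algebra.
From mathcomp Require Import reals trigo one_point_compactification.
From mathcomp Require Import zify ring lra.
Require Import Defs.

Set Implicit Arguments.
Unset Strict Implicit.
Unset Printing Implicit Defensive.

Lemma other_elt (T : finType) (S : {set T}) x : 1 < #|S| -> exists2 y, y \in S & y != x.
Proof.
move=> S2; have /card_gt0P[y] : 0 < #|S :\ x|.
  by move: S2; rewrite (cardsD1 x S); case: (x \in S) => /=; lia.
by rewrite !inE => /andP[yx yS]; exists y.
Qed.

Lemma third_elt (T : finType) (S : {set T}) x y :
  2 < #|S| -> exists z, [/\ z \in S, z != x & z != y].
Proof.
move=> S3; have [|z] := @other_elt T (S :\ x) y.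
  by move: S3; rewrite (cardsD1 x S); case: (x \in S) => /=; lia.
by rewrite !inE => /andP[zx zS] zy; exists z.
Qed.


Section Dissections.
Variable n : nat.
Implicit Types (a b c d o s t w x y z : 'I_n.+3) (S : {set 'I_n.+3}).
Implicit Types (D : {set {set 'I_n.+3}}).

(** * Cyclic order on the vertices of the polygon *)

Lemma arcE x y z :
  arc x y z = [|| x < z < y, y <= x < z | z < y <= x].
Proof. by rewrite /arc; case: ltnP => h; lia. Qed.

(** The number of steps forward from [x] to [y] around the polygon. *)
Definition gap x y : nat := if x <= y then y - x else y + n.+3 - x.

Lemma gap_inj x : injective (gap x).
Proof.
move=> y z; have := ltn_ord x; have := ltn_ord y; have := ltn_ord z.
rewrite /gap => h1 h2 h3 h; apply: val_inj => /=; move: h.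
by case: (leqP x y); case: (leqP x z); lia.
Qed.

(** Betweenness is invariant under rotation, so any vertex [o] can serve as origin and cyclic
    statements become linear arithmetic. *)
Lemma arc_gap o x y z : arc x y z =
  [|| gap o x < gap o z < gap o y, gap o y <= gap o x < gap o z
    | gap o z < gap o y <= gap o x].
Proof.
have := ltn_ord o; have := ltn_ord x; have := ltn_ord y; have := ltn_ord z.
rewrite arcE /gap; case: (leqP o x); case: (leqP o y); case: (leqP o z); lia.
Qed.

Lemma gapxx x : gap x x = 0.
Proof. by rewrite /gap leqnn subnn. Qed.

Lemma ordSE x : ordS x = (if x.+1 == n.+3 then 0 else x.+1) :> nat.
Proof.
rewrite /=; case: eqP => [->|h]; first by rewrite modnn.
by rewrite modn_small //; have := ltn_ord x; lia.
Qed.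

Lemma gapS x : gap x (ordS x) = 1.
Proof. have := ltn_ord x; rewrite /gap ordSE; case: eqP => h; case: (leqP x _); lia. Qed.

Lemma arc_ordS x z : ~~ arc x (ordS x) z.
Proof. have := ltn_ord x; have := ltn_ord z; rewrite arcE ordSE; case: eqP; lia. Qed.

Lemma edge_sym D x y : edge D x y = edge D y x.
Proof. by rewrite /edge /side setUC orbC [in RHS]orbC; congr (_ || _); apply: orbC. Qed.

(** * Neighbouring vertices within a vertex set *)

Definition next_in S x y : bool :=
  [&& x \in S, y \in S, x != y & [forall z in S, ~~ arc x y z]].

Lemma next_inP S x y :
  reflect [/\ x \in S, y \in S, x <> y :> nat & {in S, forall z, ~~ arc x y z}]
          (next_in S x y).
Proof.
apply: (iffP and4P) => -[xS yS xy h]; split=> //.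
- by move=> e; case/eqP: xy; apply: val_inj.
- exact/forall_inP.
- by apply/eqP => e; apply: xy; rewrite e.
- exact/forall_inP.
Qed.

(** The vertex of [S] other than [x] at least forward distance from [x] will do; [x] itself may lie
    outside [S]. *)
Lemma exists_succ S x y : y \in S -> y != x ->
  exists s, [/\ s \in S, s != x & {in S, forall z, ~~ arc x s z}].
Proof.
move=> yS yx.
have Py : (y \in S) && (y != x) by rewrite yS.
case: (@arg_minnP _ y (fun z => (z \in S) && (z != x)) (gap x) Py) => s /andP[sS sx] smin.
exists s; split=> // z zS; apply/negP; rewrite (arc_gap x) gapxx => h.
have zx : z != x by apply: contraTneq h => ->; rewrite gapxx; lia.
have := smin z; rewrite zS zx => /(_ isT).
have : gap x s != 0 by rewrite -(gapxx x) (inj_eq (@gap_inj x)).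
lia.
Qed.

Lemma exists_pred S x y : y \in S -> y != x ->
  exists s, [/\ s \in S, s != x & {in S, forall z, ~~ arc s x z}].
Proof.
move=> yS yx.
have Py : (y \in S) && (y != x) by rewrite yS.
case: (@arg_maxnP _ y (fun z => (z \in S) && (z != x)) (gap x) Py) => s /andP[sS sx] smax.
exists s; split=> // z zS; apply/negP; rewrite (arc_gap x) gapxx => h.
have zx : z != x by apply: contraTneq h => ->; rewrite gapxx; lia.
have := smax z; rewrite zS zx => /(_ isT).
have : gap x s != 0 by rewrite -(gapxx x) (inj_eq (@gap_inj x)).
lia.
Qed.

(** The predecessor and the successor of [z] in [S] are next to each other in [S]: a vertex of [S]
    between them would be nearer to [z]. *)
Lemma exists_enclosing S z : z \notin S -> 1 < #|S| ->
  exists s t, next_in S s t /\ arc s t z.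
Proof.
move=> zS S2; have [y yS yz] := other_elt z S2.
have [s [sS sz sP]] := exists_pred yS yz.
have [t [tS tz tP]] := exists_succ yS yz.
(* A second vertex of [S] excludes [s = t]. *)
have [u uS us] := other_elt s S2.
have [v vS vt] := other_elt t S2.
exists s, t.
have := sP t tS; have := tP s sS; have := sP u uS; have := tP u uS.
rewrite -!(inj_eq val_inj) /= in us sz tz vt *.
have uz : u <> z :> nat by move=> h; case/negP: zS; rewrite -(val_inj h).
rewrite !arcE => h1 h2 h3 h4.
split; last by lia.
apply/next_inP; split=> //; first by lia.
move=> w wS; have := sP w wS; have := tP w wS; rewrite !arcE.
have wz : w <> z :> nat by move=> h; case/negP: zS; rewrite -(val_inj h).
lia.
Qed.

Lemma next_in_exists S x : 1 < #|S| -> x \in S -> exists y, next_in S x y.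
Proof.
move=> S2 xS; have [y yS yx] := other_elt x S2.
have [s [sS sx sP]] := exists_succ yS yx.
by exists s; apply/next_inP; split=> // h; case/eqP: sx; apply: val_inj.
Qed.

Lemma next_in_inj S x y z : next_in S x z -> next_in S y z -> x = y.
Proof.
case/next_inP=> xS zS xz hx /next_inP[yS _ yz hy].
have := hx y yS; have := hy x xS; rewrite !arcE => h1 h2.
by apply: val_inj => /=; lia.
Qed.

Lemma next_in_uniq S x y z : next_in S x y -> next_in S x z -> y = z.
Proof.
case/next_inP=> xS yS xy hy /next_inP[_ zS xz hz].
have := hz y yS; have := hy z zS; rewrite !arcE => h1 h2.
by apply: val_inj => /=; lia.
Qed.

Lemma consecutiveE S x y : x \in S -> y \in S -> x != y ->
  consecutive S x y = next_in S x y || next_in S y x.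
Proof. by move=> xS yS xy; rewrite /consecutive /next_in xS yS (eq_sym y) xy. Qed.

(** * Edges and cells of a noncrossing dissection *)

Lemma cellsP D S :
  reflect (2 < #|S| /\ {in S &, forall x y, x != y -> edge D x y = consecutive S x y})
          (S \in cells D).
Proof.
rewrite inE; apply: (iffP andP) => -[S3 h]; split=> //.
  move=> x y xS yS xy; move/forall_inP: h.
  by move=> /(_ x xS) /forall_inP /(_ y yS) /implyP /(_ xy) /eqP.
by apply/forall_inP=> x xS; apply/forall_inP=> y yS; apply/implyP=> xy; rewrite h.
Qed.

Lemma cell_edge D S x y : S \in cells D -> next_in S x y -> edge D x y.
Proof.
move=> /cellsP[_ SP] xy; have [xS yS /eqP xny _] := next_inP _ _ _ xy.
by rewrite SP // consecutiveE // xy.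
Qed.

(** A side of the polygon has no vertex on one of its two arcs, so it crosses nothing. *)
Lemma edge_noncrossing D a b c d :
  noncrossing D -> a <> b :> nat -> edge D a b -> edge D c d -> ~~ crosses a b c d.
Proof.
move=> Dnc ab; rewrite /edge /crosses.
case: (boolP (side a b)) => [|_] /=.
  case/orP => /eqP-> _ _; apply/negP => /andP[]; do ?by rewrite (negPf (arc_ordS _ _)).
case: (boolP (side c d)) => [|_] /=; last exact: Dnc.
have H x y (w z : 'I_n.+3) :
    w <> z :> nat -> y = ordS x -> arc z w x -> arc w z y -> False.
  move=> wz ->; have := arc_ordS x z; have := arc_ordS x w; rewrite !arcE; have := ordSE x.
  by have := ltn_ord x; have := ltn_ord w; have := ltn_ord z; case: eqP => ? ? ? ? ->; lia.
case/orP => /eqP e _ _; apply/negP => /andP[h1 h2].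
  by apply: H e h1 h2 => /esym.
exact: H e h2 h1.
Qed.

(* Walking along the boundary of a cell from one side of [a, b] to the other
   must pass through both ends, which would make [a, b] a diagonal of the cell. *)
Lemma edge_not_through_cell D S a b c d : noncrossing D -> a <> b :> nat ->
  edge D a b -> S \in cells D -> c \in S -> d \in S -> ~~ crosses a b c d.
Proof.
move=> Dnc ab eab SD cS dS; apply/negP => /andP[abc bad].
have [S3 SP] := cellsP _ _ SD.
have ends x : x \notin S -> exists s t, [/\ next_in S s t, arc s t x & edge D s t].
  move=> xS; have [s [t [st stx]]] := exists_enclosing xS (ltnW S3).
  by exists s, t; split=> //; apply: cell_edge st.
have aS : a \in S.
  case: (boolP (a \in S)) => // /ends[s [t [/next_inP[sS tS st stP] sta est]]].
  have := edge_noncrossing Dnc st est eab; have := stP c cS; have := stP d dS.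
  by move: abc bad sta; rewrite /crosses !arcE; lia.
have bS : b \in S.
  case: (boolP (b \in S)) => // /ends[s [t [/next_inP[sS tS st stP] stb est]]].
  rewrite edge_sym in eab.
  have := edge_noncrossing Dnc st est eab; have := stP c cS; have := stP d dS.
  by move: abc bad stb; rewrite /crosses !arcE; lia.
have nab : a != b by apply/eqP => h; apply: ab; rewrite h.
move: eab; rewrite SP // consecutiveE //.
by case/orP => /next_inP[_ _ _ h]; [have := h c cS | have := h d dS]; rewrite ?abc ?bad.
Qed.


(** A vertex of one cell outside the other lies beyond a side of the latter; the rest of its cell
    lies there too, because no edge passes through a cell. *)
Lemma cells_separated D S S' : noncrossing D -> S \in cells D -> S' \in cells D ->
  S <> S' -> exists s t, [/\ edge D s t, s <> t :> nat,
    {in S, forall z, ~~ arc s t z} & {in S', forall z, ~~ arc t s z}].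
Proof.
move=> Dnc SD S'D SS'.
have sep S1 S2 z : S1 \in cells D -> S2 \in cells D -> z \in S2 -> z \notin S1 ->
    exists s t, [/\ edge D s t, s <> t :> nat,
      {in S1, forall z, ~~ arc s t z} & {in S2, forall z, ~~ arc t s z}].
  move=> S1D S2D zS2 zS1; have [S3 SP] := cellsP _ _ S1D.
  have [s [t [st stz]]] := exists_enclosing zS1 (ltnW S3).
  have est := cell_edge S1D st.
  have [sS tS nst h] := next_inP _ _ _ st; exists s, t; split=> // w wS2.
  apply/negP => tsw; have := edge_not_through_cell Dnc nst est S2D zS2 wS2.
  by rewrite /crosses stz tsw.
case: (boolP (S' \subset S)) => [S'S|/subsetPn[z]]; last exact: sep.
case: (boolP (S \subset S')) => [S_S'|/subsetPn[z zS zS']].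
  by case: SS'; apply/eqP; rewrite eqEsubset S_S'.
have [s [t [e st h1 h2]]] := sep _ _ _ S'D SD zS zS'.
by exists t, s; split=> //; [rewrite edge_sym | move=> h; apply: st].
Qed.

Lemma separated_common s t x y : s <> t :> nat -> x <> y :> nat ->
  ~~ arc s t x -> ~~ arc s t y -> ~~ arc t s x -> ~~ arc t s y ->
  (x = s /\ y = t) \/ (x = t /\ y = s).
Proof.
rewrite !arcE => st xy *.
have [[xs yt]|[xt ys]] : (x = s :> nat /\ y = t :> nat) \/ (x = t :> nat /\ y = s :> nat).
  by lia.
  by left; split; apply: val_inj.
by right; split; apply: val_inj.
Qed.

(** Distinct cells can share only the ends of a separating edge. Hence a new neighbour of an odd
    vertex is counted in one cell only. *)
Lemma cells_common_diagonal D S S' x y : noncrossing D ->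
  S \in cells D -> S' \in cells D -> x \in S -> y \in S -> x \in S' -> y \in S' ->
  x != y -> ~~ edge D x y -> S = S'.
Proof.
move=> Dnc SD S'D xS yS xS' yS' xy nxy; apply/eqP; apply: contraNT nxy => /eqP SS'.
have [s [t [e st h1 h2]]] := cells_separated Dnc SD S'D SS'.
have nxy : x <> y :> nat by move=> h; case/eqP: xy; apply: val_inj.
by have [[-> ->]|[-> ->]] := separated_common st nxy (h1 x xS) (h1 y yS)
  (h2 x xS') (h2 y yS'); rewrite // edge_sym.
Qed.

(** An edge separating distinct cells would also separate the two segments. *)
Lemma cells_diagonals_cross D S S' a b c d : noncrossing D ->
  S \in cells D -> S' \in cells D -> a \in S -> b \in S -> c \in S' -> d \in S' ->
  a <> b :> nat -> crosses a b c d -> S = S'.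
Proof.
move=> Dnc SD S'D aS bS cS' dS' ab; rewrite /crosses !arcE => acbd.
apply/eqP; apply/negPn/negP => /eqP SS'.
have [s [t [_ st h1 h2]]] := cells_separated Dnc SD S'D SS'.
have := h1 a aS; have := h1 b bS; have := h2 c cS'; have := h2 d dS'.
by rewrite !arcE; lia.
Qed.

(** Both cells lie on the same side of [x, y]. A separating edge could only be [x, y] itself, and
    would push a third vertex of one cell to the other side. *)
Lemma cells_next_in D S S' x y : noncrossing D ->
  S \in cells D -> S' \in cells D -> next_in S x y -> next_in S' x y -> S = S'.
Proof.
move=> Dnc SD S'D /next_inP[xS yS nxy k1] /next_inP[xS' yS' _ k2].
apply/eqP; apply/negPn/negP => /eqP SS'.
have [s [t [_ st h1 h2]]] := cells_separated Dnc SD S'D SS'.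
have [[S3 _] [S'3 _]] := (cellsP _ _ SD, cellsP _ _ S'D).
have [z [zS zx zy]] := third_elt x y S3.
have [w [wS wx wy]] := third_elt x y S'3.
have [[xs yt]|[xt ys]] := separated_common st nxy (h1 x xS) (h1 y yS)
  (h2 x xS') (h2 y yS').
  have := h2 w wS; have := k2 w wS; move: wx wy st.
  by rewrite -!(inj_eq val_inj) -xs -yt !arcE /=; lia.
have := h1 z zS; have := k1 z zS; move: zx zy st.
by rewrite -!(inj_eq val_inj) -xt -ys !arcE /=; lia.
Qed.

(** * The cell behind a given edge *)

(* The vertices from x to y that no other member of D cuts off from the segment
   [x, y]; gap x is a linear coordinate that starts at x. *)
Definition side_cell D x y : {set 'I_n.+3} :=
  [set z | (gap x z <= gap x y) && ~~ [exists a, exists b,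
     [&& [set a; b] \in D, gap x a < gap x z < gap x b, gap x b <= gap x y
       & ~~ ((a == x) && (b == y))]]].

Section SideCell.
Variables (D : {set {set 'I_n.+3}}) (x y : 'I_n.+3).
Hypotheses (Dnc : noncrossing D) (xy : x != y) (exy : edge D x y) (yS : y != ordS x).
Let g := gap x.
Let g_inj : injective g := @gap_inj x.

Lemma side_cellP z : reflect
  (g z <= g y /\ forall a b, [set a; b] \in D -> g b <= g y -> (a, b) <> (x, y) ->
     ~~ (g a < g z < g b)) (z \in side_cell D x y).
Proof.
rewrite inE; apply: (iffP andP) => -[zy h]; split=> //.
  move=> a b abD bgy ab; apply: contra h => h.
  apply/existsP; exists a; apply/existsP; exists b; apply/and4P; split=> //.
  by apply/andP => -[/eqP ax /eqP yb]; case: ab; rewrite ax yb.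
apply/existsP => -[a /existsP[b /and4P[abD azb bgy ab]]].
have nab : (a, b) <> (x, y) by move=> -[ax yb]; case/negP: ab; rewrite ax yb !eqxx.
by have := h a b abD bgy nab; rewrite azb.
Qed.

(** The only side with vertices between its ends in the coordinate [g] is the one that steps over
    the origin [x]; the bound by [g y] makes it [x, y]. *)
Lemma side_gap a b z :
  side a b -> g a < g b <= g y -> (a, b) <> (x, y) -> ~~ (g a < g z < g b).
Proof.
case/orP => /eqP e ab abxy.
  by have := arc_ordS a z; rewrite -e (arc_gap x) -!/(g _); lia.
case: abxy; have := arc_ordS b x; have := arc_ordS b y.
rewrite -e !(arc_gap x) gapxx -!/(g _) => h1 h2.
have -> : a = x by apply: g_inj; rewrite /g gapxx -/g; lia.
by have -> : b = y by apply: g_inj; lia.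
Qed.

Lemma side_cell_edge a b z : z \in side_cell D x y -> edge D a b -> g a < g b <= g y ->
  (a, b) <> (x, y) -> ~~ (g a < g z < g b).
Proof.
move=> /side_cellP[_ zP] /orP[ab|ab] /andP[h1 h2] h3; last exact: zP.
by apply: side_gap; rewrite ?h1.
Qed.

(** Follow the edge from [s] that reaches farthest without passing [y]. A member of [D] cutting off
    its end [t] would cut off [s] if it started before [s], contradict maximality if it started at
    [s], and cross [s, t] if it started later. *)
Lemma side_cell_succ s : s \in side_cell D x y -> s <> y ->
  exists t, [/\ t \in side_cell D x y, edge D s t, g s < g t & (s, t) <> (x, y)].
Proof.
move=> sS sy; have [sgy sP] := side_cellP _ sS.
have gsy : g s <> g y by move=> /g_inj.
pose P t := [&& edge D s t, g s < g t <= g y & (s, t) != (x, y)].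
(* The side leaving [s] is a candidate; it is not [x, y], by [yS]. *)
have P0 : P (ordS s).
  apply/and3P; split; first by rewrite /edge /side eqxx.
    have : ordS s != s.
      by apply/eqP => h; have := gapS s; rewrite h gapxx.
    rewrite -(inj_eq g_inj); have := arc_ordS s x; have := arc_ordS s y.
    rewrite !(arc_gap x) gapxx -!/(g _); lia.
  by apply/eqP => -[h k]; move: yS; rewrite -k h eqxx.
case: (arg_maxnP g P0) => t /and3P[est /andP[gst gty] /eqP stxy] tmax.
exists t; split=> //; apply/side_cellP; split=> // a b abD bgy abxy.
apply/negP => /andP[at_ tb].
have eab : edge D a b by rewrite /edge abD orbT.
have sas : g a < g s -> False.
  by move=> h; have := sP a b abD bgy abxy; rewrite h (ltn_trans gst tb).
case: (ltngtP (g a) (g s)) => // [gsa|/g_inj as_].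
  have nst : s <> t :> nat by move=> /val_inj h; move: gst; rewrite h ltnn.
  have := edge_noncrossing Dnc nst est eab.
  by rewrite /crosses !(arc_gap x) -!/(g _); lia.
have := tmax b; rewrite /P -as_ eab bgy andbT.
have -> : g a < g b by lia.
have -> : (a, b) != (x, y) by apply/eqP.
by move=> /(_ isT) /=; lia.
Qed.

Lemma side_cell_l : x \in side_cell D x y.
Proof. by apply/side_cellP; rewrite /g gapxx; split=> // a b _ _ _; rewrite ltn0. Qed.

Lemma side_cell_r : y \in side_cell D x y.
Proof. by apply/side_cellP; split=> // a b _ h _; lia. Qed.

Lemma side_cell_next : next_in (side_cell D x y) y x.
Proof.
apply/next_inP; split; rewrite ?side_cell_r ?side_cell_l //.
  by move=> h; case/eqP: xy; apply/esym/val_inj.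
move=> z /side_cellP[h _]; rewrite (arc_gap x) gapxx -!/(g _).
have : g x <> g y by move=> /g_inj e; case/eqP: xy.
by rewrite /g gapxx; move: h; rewrite /g; lia.
Qed.

(** Edges are consecutive because whatever they cut off was discarded; consecutive vertices are
    joined because [side_cell_succ] leads from each vertex along an edge to the next one. *)
Lemma side_cell_in_cells : side_cell D x y \in cells D.
Proof.
apply/cellsP; split.
  have [|t [tS ext gxt xtxy]] := side_cell_succ side_cell_l; first exact/eqP.
  have tx : t != x by apply: contraTneq gxt => ->; rewrite ltnn.
  have ty : t != y by apply/eqP => h; apply: xtxy; rewrite h.
  apply: (@leq_trans #|[set x; y; t]|).
    by rewrite setUC cardsU1 cards2 !inE negb_or tx ty xy.
  apply/subset_leq_card/subsetP=> z.
  by case/setUP=> [/set2P[]|/set1P] ->; rewrite ?side_cell_l ?side_cell_r.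
move=> a b; wlog ab : a b / g a < g b => [hw|] aS bS nab.
  case: (ltngtP (g a) (g b)) => [h|h|/g_inj/eqP]; first exact: hw.
    by rewrite edge_sym hw // 1?eq_sym // /consecutive orbC.
  by rewrite (negPf nab).
have [[agy _] [bgy _]] := (side_cellP _ aS, side_cellP _ bS).
have arcg z : arc a b z = (g a < g z < g b) by rewrite (arc_gap x) -!/(g _); lia.
have arcg' z : arc b a z = (g b < g z) || (g z < g a) by rewrite (arc_gap x) -!/(g _); lia.
apply/idP/idP => [eab|/orP[]/forall_inP h].
- have [[-> ->]|abxy] := @eqP _ (a, b) (x, y).
    by rewrite consecutiveE ?side_cell_l ?side_cell_r // side_cell_next orbT.
  apply/orP; left; apply/forall_inP => z zS; rewrite arcg.
  by apply: side_cell_edge zS eab _ abxy; rewrite ab.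
- have [ay|t [tS eat gat atxy]] := side_cell_succ aS.
    by move: ab; rewrite ay ltnNge bgy.
  have := h t tS; rewrite arcg gat /= -leqNgt => gbt.
  have [tgy _] := side_cellP _ tS.
  have := side_cell_edge bS eat _ atxy; rewrite gat tgy ab -leqNgt => /(_ isT) gtb.
  by have <- : t = b by apply: g_inj; lia.
(* No vertex of the cell lies outside the interval from [a] to [b], so these are the extreme
   vertices [x] and [y]. *)
- have := h x side_cell_l; have := h y side_cell_r; rewrite !arcg' /g gapxx -!/(g _) => h1 h2.
  have -> : a = x by apply: g_inj; rewrite /g gapxx -!/(g _); lia.
  by have -> : b = y by apply: g_inj; lia.
Qed.

End SideCell.

(** The cell lies on the arc from [x] forward to [y], which has interior vertices by the last
    hypothesis. *)
Lemma cell_exists D x y : noncrossing D -> x != y -> edge D x y -> y != ordS x ->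
  exists2 S, S \in cells D & next_in S y x.
Proof.
move=> Dnc xy exy yS; exists (side_cell D x y); first exact: side_cell_in_cells.
exact: side_cell_next.
Qed.

(** * Counting the cells at a vertex *)

Definition succ_in S x : 'I_n.+3 := odflt x [pick y | next_in S x y].

Lemma succ_inP S x : 1 < #|S| -> x \in S -> next_in S x (succ_in S x).
Proof.
move=> S2 xS; rewrite /succ_in; case: pickP => //= h.
by have [y] := next_in_exists S2 xS; rewrite h.
Qed.

Lemma succ_in_mem S x : 1 < #|S| -> x \in S -> succ_in S x \in S.
Proof. by move=> S2 xS; case/next_inP: (succ_inP S2 xS). Qed.

Lemma succ_inE S x y : next_in S x y -> succ_in S x = y.
Proof.
move=> xy; rewrite /succ_in; case: pickP => /= [z xz|/(_ y)]; last by rewrite xy.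
exact: next_in_uniq xz xy.
Qed.

Lemma succ_in_inj S : 1 < #|S| -> {in S &, injective (succ_in S)}.
Proof.
move=> S2 x y xS yS e; apply: (@next_in_inj S x y (succ_in S x)); first exact: succ_inP.
by rewrite e; apply: succ_inP.
Qed.

Definition neighbours D x : {set 'I_n.+3} := [set y | (y != x) && edge D x y].

(* The cells at x correspond to the neighbours of x other than the preceding
   vertex of P: send a cell to its vertex following x. *)
Lemma card_neighbours D x : noncrossing D -> #|neighbours D x| = (incident_cells D x).+1.
Proof.
move=> Dnc; rewrite /incident_cells; set A := [set S in _ | _].
have AP S : S \in A -> [/\ S \in cells D, x \in S, 2 < #|S| & next_in S x (succ_in S x)].
  rewrite inE => /andP[SD xS]; have [S3 _] := cellsP _ _ SD.
  by split=> //; apply: succ_inP => //; apply: ltnW.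
have inj : {in A &, injective (fun S => succ_in S x)}.
  move=> S S' /AP[SD _ _ Sx] /AP[S'D _ _ S'x] e.
  by apply: cells_next_in Dnc SD S'D Sx _; rewrite e.
have px : ord_pred x != x.
  by apply/eqP => h; have := gapS (ord_pred x); rewrite ord_predK h gapxx.
have pN : ord_pred x \in neighbours D x.
  by rewrite inE px /edge /side ord_predK eqxx orbT.
rewrite -(card_in_imset inj) (cardsD1 (ord_pred x) (neighbours D x)) pN add1n; congr _.+1.
apply: eq_card => y; apply/idP/imsetP.
  rewrite !inE => /and3P[yp yx exy].
  have xSy : x != ordS y by apply: contra yp => /eqP ->; rewrite ordSK.
  rewrite edge_sym in exy; have [S SD xy] := cell_exists Dnc yx exy xSy.
  exists S; last by rewrite (succ_inE xy).
  by rewrite inE SD; case/next_inP: xy.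
move=> [S SA ->]; have [SD xS S3 Sx] := AP S SA.
rewrite !inE (cell_edge SD Sx) andbT.
have [_ yS nxy noarc] := next_inP _ _ _ Sx.
apply/andP; split; last by apply/eqP => h; apply: nxy; rewrite h.
(* The way forward from [x] to its predecessor passes all other vertices, including a third vertex
   of the cell. *)
apply/eqP => h; have [z [zS zx zy]] := third_elt x (succ_in S x) S3.
have := noarc z zS; have := arc_ordS (ord_pred x) z; rewrite ord_predK -h.
move: zx zy; rewrite -!(inj_eq val_inj) !arcE /=; lia.
Qed.

(** * Parity of the ends of an edge *)

(** Since [succ_in S] permutes [S], both parities have the same sum over [S]. *)
Lemma sum_parity_changes S : 1 < #|S| ->
  \big[addb/false]_(s in S) (odd s (+) odd (succ_in S s)) = false.
Proof.
move=> S2; rewrite big_split /=.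
have -> : \big[addb/false]_(s in S) odd (succ_in S s) = \big[addb/false]_(s in S) odd s.
  have imS : [set succ_in S s | s in S] = S.
    apply/eqP; rewrite eqEcard (card_in_imset (succ_in_inj S2)) leqnn andbT.
    by apply/subsetP => _ /imsetP[s sS ->]; apply: succ_in_mem.
  by rewrite -[in RHS]imS big_imset //; apply: succ_in_inj.
by rewrite addbb.
Qed.

Lemma big_addb_true (S : {set 'I_n.+3}) : \big[addb/false]_(s in S) true = odd #|S|.
Proof. by rewrite -sum1_card (big_morph odd oddD (erefl _)). Qed.

(** Around a cell the parity changes an even number of times; the sides other than the one leaving
    [y] account for an odd number. *)
Lemma even_cell_edge S y : ~~ odd #|S| -> 1 < #|S| -> y \in S ->
  {in S, forall s, s != y -> odd s != odd (succ_in S s)} -> odd y != odd (succ_in S y).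
Proof.
move=> Seven S2 yS h; have := sum_parity_changes S2.
rewrite (big_setD1 y) //= (eq_bigr (fun _ => true)) => [|s]; last first.
  by rewrite !inE => /andP[sy sS]; move: (h s sS sy); case: odd; case: odd.
rewrite big_addb_true; move: Seven; rewrite (cardsD1 y S) yS /= negbK => ->.
by case: odd; case: odd.
Qed.

Lemma not_arc_between x y z : x < y -> ~~ arc y x z -> x <= z <= y.
Proof. by rewrite arcE; lia. Qed.

(** The decrease for the induction on the length of an edge: [z] excludes the case [s = x],
    [t = y]. *)
Lemma gap_shrinks x y s t z : x < y -> s != y -> z != s -> z != t ->
  ~~ arc y x s -> ~~ arc y x t -> ~~ arc y x z -> ~~ arc s t y -> ~~ arc s t z ->
  s < t /\ t - s < y - x.
Proof.
rewrite -!(inj_eq val_inj) /= => xy sy zs zt.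
move=> /(not_arc_between xy) hs /(not_arc_between xy) ht /(not_arc_between xy) hz.
rewrite !arcE => hy hst; have st : s < t by lia.
by split=> //; lia.
Qed.

(** Induction on [y - x]: the other sides of the cell behind [x, y] are shorter, hence change
    parity, and the even cell forces the last change. The side from 0 to n + 2 is treated like a
    diagonal, so the evenness of n + 3 comes out of the induction. *)
Lemma edge_parity_lt D x y : noncrossing D -> (forall S, S \in cells D -> ~~ odd #|S|) ->
  x < y -> edge D x y -> odd x != odd y.
Proof.
move=> Dnc Deven; have [m] := ubnP (y - x); elim: m x y => // m IH x y yxm xy exy.
have nxy : x != y by apply: contraTneq xy => ->; rewrite ltnn.
have [yS|yS] := eqVneq y (ordS x).
  move: xy; rewrite {exy yxm nxy}yS ordSE; case: eqP => //= _ _; by case: odd.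
have [S SD yx] := cell_exists Dnc nxy exy yS.
have [S3 _] := cellsP _ _ SD; have S2 := ltnW S3.
have [ynS xnS _ noarc] := next_inP _ _ _ yx.
rewrite eq_sym -(succ_inE yx); apply: (even_cell_edge (Deven _ SD) S2 ynS).
move=> s sS sy; have ss := succ_inP S2 sS; set t := succ_in S s in ss *.
have [_ tS nst h] := next_inP _ _ _ ss.
have [z [zS zs zt]] := third_elt s t S3.
have [||st stxy] := gap_shrinks xy sy zs zt (noarc s sS) (noarc t tS) (noarc z zS).
- exact: h.
- exact: h.
apply: IH (leq_trans stxy _) st (cell_edge SD ss); exact: yxm.
Qed.

Lemma edge_parity D x y : noncrossing D -> (forall S, S \in cells D -> ~~ odd #|S|) ->
  x != y -> edge D x y -> odd x != odd y.
Proof.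
move=> Dnc Deven; rewrite -(inj_eq val_inj) /= => xy exy.
case: (ltngtP x y) => h; [exact: edge_parity_lt exy | | by rewrite h eqxx in xy].
by rewrite eq_sym; rewrite edge_sym in exy; apply: edge_parity_lt exy.
Qed.

(** The injection [succ_in S] exchanges odd and even vertices of the cell. *)
Lemma card_odd_cell D S : noncrossing D -> (forall S, S \in cells D -> ~~ odd #|S|) ->
  S \in cells D -> #|S| = #|[set s in S | odd s]|.*2.
Proof.
move=> Dnc Deven SD; have [S3 _] := cellsP _ _ SD; have S2 := ltnW S3.
have flip s : s \in S -> odd (succ_in S s) = ~~ odd s.
  move=> sS; have ss := succ_inP S2 sS; have [_ _ nst _] := next_inP _ _ _ ss.
  have := edge_parity Dnc Deven _ (cell_edge SD ss).
  have -> : s != succ_in S s by apply/eqP => h; apply: nst; rewrite -h.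
  by move=> /(_ isT); case: odd; case: odd.
pose B (b : bool) := [set s in S | odd s == b].
have le (b : bool) : #|B b| <= #|B (~~ b)|.
  rewrite -(@card_in_imset _ _ (succ_in S) (B b)); last first.
    by move=> s t /setIdP[sS _] /setIdP[tS _]; apply: succ_in_inj.
  apply/subset_leq_card/subsetP => _ /imsetP[s /setIdP[sS /eqP sb] ->].
  by rewrite inE succ_in_mem //= flip // sb.
have BT : [set s in S | odd s] = B true by apply/setP => s; rewrite !inE eqb_id.
have -> : #|S| = #|B true| + #|B false|.
  rewrite -(cardsID (B true) S); congr (_ + _); apply: eq_card => s; rewrite !inE;
  by case: (s \in S); case: odd.
by rewrite BT; have := le true; have := le false; rewrite /= -addnn; lia.
Qed.

(** * The triangulation by odd diagonals *)

Lemma diagonal_neq a b : [set a; b] \in diagonals n -> a != b.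
Proof.
rewrite inE => /existsP[x /existsP[y /and3P[xy _ /eqP e]]].
have := cards2 a b; rewrite e cards2 xy; by case: (a != b).
Qed.

Lemma diagonals_side a b : a != b -> ~~ side a b -> [set a; b] \in diagonals n.
Proof.
move=> ab sab; rewrite inE; apply/existsP; exists a; apply/existsP; exists b.
by rewrite ab sab eqxx.
Qed.

Lemma crosses_uniq a b c d : a <> b :> nat -> crosses a b c d -> uniq [:: a; b; c; d].
Proof. by rewrite /= !inE -!(inj_eq val_inj) /= /crosses !arcE; lia. Qed.

Definition odd_pair S a b : bool := [&& a \in S, b \in S, odd a & odd b].

Lemma odd_triangulationP D a b : reflect
  ([set a; b] \in D \/ [set a; b] \in diagonals n /\
     exists2 S, S \in cells D & odd_pair S a b)
  ([set a; b] \in odd_triangulation D).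
Proof.
apply: (iffP setUP) => -[abD|]; [by left | | by left | ].
  move=> /setIdP[ab /andP[/exists_inP[S SD abS] /forall_inP o]]; right; split=> //.
  by exists S => //; rewrite /odd_pair !(subsetP abS) ?o ?set21 ?set22.
move=> [ab [S SD /and4P[aS bS oa ob]]]; right; apply/setIdP; split=> //.
apply/andP; split; last by apply/forall_inP => _ /set2P[]->.
by apply/exists_inP; exists S => //; apply/subsetP => _ /set2P[]->.
Qed.

(** The membership in [diagonals] disappears: a pair that is not a diagonal is a side, hence already
    an edge. *)
Lemma edge_odd_triangulation D a b : a != b ->
  edge (odd_triangulation D) a b = edge D a b || [exists S in cells D, odd_pair S a b].
Proof.
move=> ab; rewrite /edge -orbA; case: (boolP (side a b)) => //= sab.
apply/odd_triangulationP/orP => -[|]; [by left | | by left |].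
  by case=> _ [S SD o]; right; apply/exists_inP; exists S.
move=> /exists_inP[S SD o]; right; split; last by exists S.
exact: diagonals_side.
Qed.

Section Angulation.
Variables (h : nat) (D : {set {set 'I_n.+3}}).
Hypotheses (Dd : D \subset diagonals n) (Dnc : noncrossing D).
Hypothesis (Dcell : forall S, S \in cells D -> #|S| = h.*2).

Lemma cell_even S : S \in cells D -> ~~ odd #|S|.
Proof. by move=> /Dcell->; rewrite odd_double. Qed.

Lemma card_odd_vertices S : S \in cells D -> #|[set s in S | odd s]| = h.
Proof.
move=> SD; apply: double_inj; rewrite -(Dcell SD).
by rewrite -(card_odd_cell Dnc cell_even SD).
Qed.

(** Members of [D] cross neither each other nor segments inside cells. Two added diagonals that
    cross share their cell, which would then have four odd vertices. *)
Lemma noncrossing_odd_triangulation : h <= 3 -> noncrossing (odd_triangulation D).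
Proof.
move=> h3 a b c d abT cdT; apply/negP => cr.
have ab : a != b.
  by case/odd_triangulationP: abT => [/(subsetP Dd)|[+ _]]; apply: diagonal_neq.
have nab : a <> b :> nat by move=> e; case/eqP: ab; apply: val_inj.
(* Crossing is symmetric, so the case with only [c, d] in [D] also reduces to [nthrough]. *)
have cr' : crosses c d b a /\ c <> d :> nat by move: cr; rewrite /crosses !arcE; lia.
have [{}cr' ncd] := cr'.
have nthrough x y z w S : x <> y :> nat -> [set x; y] \in D -> S \in cells D ->
    z \in S -> w \in S -> ~~ crosses x y z w.
  by move=> xy xyD; apply: edge_not_through_cell => //; rewrite /edge xyD orbT.
case/odd_triangulationP: abT => [abD|[_ [S SD /and4P[aS bS oa ob]]]];
  case/odd_triangulationP: cdT => [cdD|[_ [S' S'D /and4P[cS dS oc od]]]].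
- by have := Dnc abD cdD; rewrite cr.
- by have := nthrough _ _ _ _ _ nab abD S'D cS dS; rewrite cr.
- by have := nthrough _ _ _ _ _ ncd cdD SD bS aS; rewrite cr'.
have SS := cells_diagonals_cross Dnc SD S'D aS bS cS dS nab cr; subst S'.
move: h3; apply/negP; rewrite -ltnNge -(card_odd_vertices SD).
apply: (@leq_trans (size [:: a; b; c; d])) => //.
have u := crosses_uniq nab cr.
rewrite -(card_uniqP u); apply/subset_leq_card/subsetP => w.
by rewrite !inE => /or4P[] /eqP->; rewrite ?aS ?bS ?cS ?dS.
Qed.

Lemma neighbours_odd_triangulation_even x : ~~ odd x ->
  neighbours (odd_triangulation D) x = neighbours D x.
Proof.
move=> ox; apply/setP => y; rewrite !inE; have [//|yx] := eqVneq y x.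
rewrite edge_odd_triangulation 1?eq_sym //=.
rewrite (_ : [exists S in _, _] = false) ?orbF //.
by apply/exists_inP => -[S _ /and4P[_ _]]; rewrite (negPf ox).
Qed.

(** Double counting of the pairs of a cell at [x] and another odd vertex of that cell. *)
Lemma card_neighbours_odd_triangulation_odd x : odd x ->
  #|neighbours (odd_triangulation D) x| =
  #|neighbours D x| + incident_cells D x * h.-1.
Proof.
move=> ox; rewrite /incident_cells; set A := [set S in cells D | x \in S].
have sub : neighbours D x \subset neighbours (odd_triangulation D) x.
  apply/subsetP => y; rewrite !inE => /andP[yx exy]; rewrite yx.
  by rewrite edge_odd_triangulation 1?eq_sym // exy.
rewrite -(cardsID (neighbours D x)) (setIidPr sub); congr (_ + _).
pose Q S : {set 'I_n.+3} := [set s in S | odd s] :\ x.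
have QE S : S \in A -> #|Q S| = h.-1.
  move=> /setIdP[SD xS]; rewrite -(card_odd_vertices SD).
  by rewrite (cardsD1 x [set s in S | odd s]) inE xS ox.
rewrite -sum_nat_const -(eq_bigr _ QE).
under eq_bigr => S _ do rewrite -sum1_card.
(* Each new neighbour lies in exactly one cell with [x]. Conversely, the odd vertices of [Q S] are
   new, since edges of [D] join opposite parities. *)
rewrite (exchange_big_dep (mem (neighbours (odd_triangulation D) x :\: neighbours D x))) /=.
  rewrite -sum1_card; apply: eq_bigr => y; rewrite !inE => /andP[yND /andP[yx exy]].
  rewrite yx /= in yND; rewrite edge_odd_triangulation 1?eq_sym // (negPf yND) /= in exy.
  case/exists_inP: exy => S SD /and4P[xS yS _ oy].
  rewrite (big_pred1 S) // => S'; apply/andP/eqP => [[]|->]; last first.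
    split; first exact/setIdP.
    by apply/setD1P; split=> //; apply/setIdP.
  move=> /setIdP[S'D xS'] /setD1P[_ /setIdP[yS' _]].
  by apply: (cells_common_diagonal Dnc _ _ xS' yS' xS yS); rewrite // eq_sym.
move=> S y /setIdP[SD xS] /setD1P[yx /setIdP[yS oy]]; rewrite !inE yx /=.
have xy : x != y by rewrite eq_sym.
rewrite edge_odd_triangulation //; apply/andP; split.
  by apply/negP => /(edge_parity Dnc cell_even xy); rewrite ox oy.
by apply/orP; right; apply/exists_inP; exists S; rewrite // /odd_pair xS yS ox oy.
Qed.

(** Cells are neighbours less one in both dissections; at an odd vertex with q cells, (q + 1) + q (h
    - 1) = q h + 1. *)
Lemma incident_odd_triangulation x : 0 < h <= 3 ->
  incident_cells (odd_triangulation D) x = incident_cells D x * (if odd x then h else 1).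
Proof.
case/andP=> h0 h3; apply: succn_inj.
rewrite -(card_neighbours x (noncrossing_odd_triangulation h3)).
case: (boolP (odd x)) => ox.
  rewrite card_neighbours_odd_triangulation_odd // card_neighbours //.
  by rewrite addSn -mulnS prednK.
by rewrite neighbours_odd_triangulation_even // card_neighbours // muln1.
Qed.

End Angulation.

End Dissections.

Import Order.TTheory GRing.Theory Num.Theory.
Local Open Scope ring_scope.

(** * Values of lambda and conjugation by dilations *)

Section Lambda.
Variable R : realType.

Lemma cos_pi_div_gt0 k : (2 < k)%N -> 0 < cos (pi / k%:R) :> R.
Proof.
move=> k2; apply: cos_gt0_pihalf; have pi0 : 0 < pi :> R := pi_gt0 R.
have lt : pi / k%:R < pi / 2 :> R.
  by rewrite ltr_pM2l // ltf_pV2 ?posrE ?ltr0n ?ltr_nat //; apply: leq_trans k2.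
have gt : 0 < pi / k%:R :> R by rewrite divr_gt0 // ltr0n (leq_trans _ k2).
by rewrite lt andbT; lra.
Qed.

Lemma lambda_gt0 k : (2 < k)%N -> 0 < lambda R k.
Proof. by move=> k2; rewrite mulr_gt0 // cos_pi_div_gt0. Qed.

Lemma lambda4_sqr : lambda R 4 ^+ 2 = 2.
Proof.
have := cos_mulr2n (pi / 4%:R : R); rewrite /lambda.
have -> : pi / 4%:R *+ 2 = pi / 2 :> R by field.
rewrite cos_pihalf; set c := cos _; move=> e; rewrite mulr2n in e; lra.
Qed.

(** Expand cos (3x) = 0 at x = pi / 6 and cancel cos x, which is nonzero. *)
Lemma cos_pi6_sqr : 4 * cos (pi / 6%:R) ^+ 2 = 3 :> R.
Proof.
set x : R := pi / 6%:R.
have e : x *+ 2 + x = pi / 2 by rewrite /x; field.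
have := cosD (x *+ 2) x; rewrite e cos_pihalf cos_mulr2n sin_mulr2n.
have c0 : cos x != 0 by rewrite gt_eqF // cos_pi_div_gt0.
have s2 := sin2cos2 x.
have -> : cos x * sin x *+ 2 * sin x = 2 * cos x * sin x ^+ 2 by ring.
rewrite s2 => h; apply: (mulfI c0); lra.
Qed.

Lemma lambda6_sqr : lambda R 6 ^+ 2 = 3.
Proof. by rewrite /lambda exprMn -cos_pi6_sqr; ring. Qed.

Lemma lambda3 : lambda R 3 = 1.
Proof.
rewrite /lambda; have -> : pi / 3%:R = pi / 6%:R *+ 2 :> R by field.
by rewrite cos_mulr2n; have := cos_pi6_sqr; lra.
Qed.

(** For finite nonzero z this is a mu - 1 / (z / a) = a (mu - 1 / z). The ratio is inverted from one
    factor to the next. *)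
Lemma xi_dilate (a mu : R) z : a != 0 ->
  xi (a * mu) (dilate a^-1 z) = dilate a (xi mu z).
Proof.
move=> a0; case: z => [z|//] /=; rewrite mulf_eq0 invr_eq0 (negPf a0) /=.
by case: (eqVneq z 0) => [//|z0] /=; congr Some; rewrite invfM invrK mulrBr.
Qed.

End Lambda.

(* Conjugating by the dilation absorbs the factor [h = lambda_p ^ 2] at the odd
   vertices; the dilations of consecutive factors cancel. *)
Lemma farey_pathE (R : realType) (n p h : nat) (D E : {set {set 'I_n.+3}}) alpha :
  0 < lambda R p -> lambda R p ^+ 2 = h%:R ->
  (forall i, incident_cells E i = (incident_cells D i * (if odd i then h else 1))%N) ->
  farey_path R 3 E alpha = dilate (lambda R p)^-1 (farey_path R p D alpha).
Proof.
move=> l0 l2 EDi; rewrite /farey_path lambda3; set l := lambda R p in l0 l2 *.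
have lneq0 : l != 0 by rewrite gt_eqF.
set s := take _ _.
(* The indices are consecutive, so odd and even factors alternate. *)
have : map val s = iota 0 (size s).
  rewrite /s map_take val_enum_ord take_iota size_take size_enum_ord ltn_ord.
  by rewrite (minn_idPl (ltnW (ltn_ord alpha))).
(* For the induction over suffixes, the ratio is made to depend on the parity of the first index. *)
rewrite -[l^-1]/(if odd 0 then l else l^-1).
elim: s 0%N => [|i s IH] k; first by case: odd.
move=> /= [ik sk]; rewrite (IH k.+1 sk) EDi -ik mulr1 /=.
set F := foldr _ _ _; rewrite natrM; case: (odd i) => /=.
  by rewrite -(xi_dilate _ _ lneq0) -l2; congr (xi _ _); ring.
rewrite -(xi_dilate _ _ (_ : l^-1 != 0)) ?invr_eq0 // invrK mulr1.
by congr (xi _ _); rewrite mulrC mulfK.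
Qed.

Theorem proposition20 (R : realType) (n p : nat) (D : {set {set 'I_n.+3}})
    (hp : p = 4%N \/ p = 6%N) (hD : p_angulation p D) (alpha : 'I_n.+3) :
  farey_path R 3 (odd_triangulation D) alpha =
  dilate (lambda R p)^-1 (farey_path R p D alpha).
Proof.
have [Dd Dnc Dcell] := hD.
(* The same number is p / 2 and the square of lambda: 2 for p = 4 and 3 for p = 6. *)
have [h [ph h3 l2]] : exists h, [/\ p = h.*2, (0 < h <= 3)%N & lambda R p ^+ 2 = h%:R].
  by case: hp => ->; [exists 2%N; rewrite lambda4_sqr | exists 3%N; rewrite lambda6_sqr].
apply: farey_pathE l2 _; first by apply: lambda_gt0; case: hp => ->.
move=> x; apply: incident_odd_triangulation => // S SD.
by rewrite -ph Dcell.
Qed.
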